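(* Let $\mathbb T$ be a Mal'cev theory such that the variety $\mathbb V(\mathbb T)$ is fiberwise algebraically cartesian closed. Then the category $Top(\mathbb T)$ of topological $\mathbb T$-algebras is fiberwise algebraically cartesian closed.
   Context: A Mal'cev theory is an algebraic theory possessing a ternary term $p$ with $p(x,y,y)=x$ and $p(x,x,y)=y$. $\mathbb V(\mathbb T)$ is the corresponding variety of $\mathbb T$-algebras, and $Top(\mathbb T)$ is the category of topological $\mathbb T$-algebras (models of $\mathbb T$ in topological spaces) and continuous homomorphisms. For a finitely complete category $\mathbb C$ and an object $Y$, $Pt_Y\mathbb C$ has as objects the pairs $(f:X\to Y,\ s:Y\to X)$ with $fs=1_Y$, and as morphisms the maps over $Y$ commuting with the sections. For $h:X\to Y$, $h^*:Pt_Y\mathbb C\to Pt_X\mathbb C$ is the change of base functor given by pulling back along $h$. A category $\mathbb D$ with products is algebraically cartesian closed when, for every object $Y$ with terminal map $\tau_Y:Y\to 1$, the functor $\tau_Y^*:Pt_1\mathbb D\to Pt_Y\mathbb D$ has a right adjoint. A finitely complete category $\mathbb C$ is fiberwise algebraically cartesian closed when every fibre $Pt_Y\mathbb C$ is algebraically cartesian closed; equivalently, when for every split epimorphism $f:X\to Y$ in $\mathbb C$ (with a splitting $s$) the functor $f^*:Pt_Y\mathbb C\to Pt_X\mathbb C$ has a right adjoint. *)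

(* Defs.v *)
From HB Require Import structures.
From mathcomp Require Import all_boot all_classical.
From mathcomp Require Import topology.

Set Implicit Arguments.
Unset Strict Implicit.
Unset Printing Implicit Defensive.

Declare Scope cat_scope.
Delimit Scope cat_scope with cat.

Record category := Category {
  obj :> Type;
  hom : obj -> obj -> Type;
  idm : forall X, hom X X;
  comp : forall X Y Z, hom Y Z -> hom X Y -> hom X Z;
  comp1m : forall X Y (f : hom X Y), comp (idm Y) f = f;
  compm1 : forall X Y (f : hom X Y), comp f (idm X) = f;
  compA : forall X Y Z W (h : hom Z W) (g : hom Y Z) (f : hom X Y),
    comp h (comp g f) = comp (comp h g) f }.

Arguments hom {c} X Y.
Arguments idm {c} X.
Arguments comp {c X Y Z} g f.

Notation "g \o f" := (comp g f) : cat_scope.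
Local Open Scope cat_scope.

Record functor (C D : category) := Functor {
  fobj :> C -> D;
  fmap : forall X Y : C, hom X Y -> hom (fobj X) (fobj Y);
  fmap1 : forall X : C, fmap (idm X) = idm (fobj X);
  fmapM : forall (X Y Z : C) (g : hom Y Z) (f : hom X Y),
    fmap (g \o f) = fmap g \o fmap f }.

Arguments fmap {C D} F {X Y} _ : rename.

Record adjunction (C D : category) (F : functor C D) (G : functor D C) :=
  Adjunction {
    adj : forall (X : C) (Y : D), hom (F X) Y -> hom X (G Y);
    adj_bij : forall (X : C) (Y : D), bijective (@adj X Y);
    adj_natl : forall (X' X : C) (Y : D) (u : hom X' X) (k : hom (F X) Y),
      adj (k \o fmap F u) = adj k \o u;
    adj_natr : forall (X : C) (Y Y' : D) (v : hom Y Y') (k : hom (F X) Y),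
      adj (v \o k) = fmap G v \o adj k }.

Definition has_right_adjoint (C D : category) (F : functor C D) : Prop :=
  exists G : functor D C, inhabited (adjunction F G).

Record terminal (C : category) := Terminal {
  one :> C;
  bang : forall X : C, hom X one;
  bang_unique : forall (X : C) (u v : hom X one), u = v }.

Arguments bang {C} t X.

Record product (C : category) (X Y : C) := Product {
  prod_obj : C;
  prod1 : hom prod_obj X;
  prod2 : hom prod_obj Y;
  prod_pair : forall W : C, hom W X -> hom W Y -> hom W prod_obj;
  prod_pair1 : forall (W : C) (a : hom W X) (b : hom W Y),
    prod1 \o prod_pair a b = a;
  prod_pair2 : forall (W : C) (a : hom W X) (b : hom W Y),
    prod2 \o prod_pair a b = b;
  prod_unique : forall (W : C) (u v : hom W prod_obj),
    prod1 \o u = prod1 \o v -> prod2 \o u = prod2 \o v -> u = v }.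

Record pullback (C : category) (X Y Z : C) (f : hom X Z) (g : hom Y Z) :=
  Pullback {
    pb_obj : C;
    pb1 : hom pb_obj X;
    pb2 : hom pb_obj Y;
    pb_comm : f \o pb1 = g \o pb2;
    pb_pair : forall (W : C) (a : hom W X) (b : hom W Y),
      f \o a = g \o b -> hom W pb_obj;
    pb_pair1 : forall (W : C) (a : hom W X) (b : hom W Y)
      (e : f \o a = g \o b), pb1 \o pb_pair e = a;
    pb_pair2 : forall (W : C) (a : hom W X) (b : hom W Y)
      (e : f \o a = g \o b), pb2 \o pb_pair e = b;
    pb_unique : forall (W : C) (u v : hom W pb_obj),
      pb1 \o u = pb1 \o v -> pb2 \o u = pb2 \o v -> u = v }.

Record finite_products (C : category) := FiniteProducts {
  fp_one : terminal C;
  fp_prod : forall X Y : C, product X Y }.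

(* A terminal object and pullbacks yield all finite limits. *)
Record finite_limits (C : category) := FiniteLimits {
  fl_one : terminal C;
  fl_pullback : forall (X Y Z : C) (f : hom X Z) (g : hom Y Z), pullback f g }.

Definition finitely_complete (C : category) : Prop := inhabited (finite_limits C).

Definition terminal_pullback (C : category) (T : terminal C) (X Y : C)
    (f : hom X T) (g : hom Y T) (P : product X Y) : pullback f g :=
  @Pullback C X Y T f g (prod_obj P) (prod1 P) (prod2 P)
    (bang_unique _ _) (fun W a b _ => prod_pair P a b)
    (fun W a b _ => prod_pair1 P a b) (fun W a b _ => prod_pair2 P a b)
    (@prod_unique _ _ _ P).

Section Points.
Variables (C : category) (Y : C).

Record point := Point {
  pt_obj :> C;
  pt_map : hom pt_obj Y;
  pt_sec : hom Y pt_obj;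
  pt_split : pt_map \o pt_sec = idm Y }.

Record point_hom (P Q : point) := PointHom {
  pt_fun :> hom P Q;
  pt_over : pt_map Q \o pt_fun = pt_map P;
  pt_under : pt_fun \o pt_sec P = pt_sec Q }.

Lemma point_hom_inj (P Q : point) (u v : point_hom P Q) :
  pt_fun u = pt_fun v -> u = v.
Proof.
case: u => u uo uu; case: v => v vo vu /= e; subst v.
by congr PointHom; exact: Prop_irrelevance.
Qed.

Definition point_id (P : point) : point_hom P P :=
  PointHom (compm1 (pt_map P)) (comp1m (pt_sec P)).

Lemma point_comp_over (P Q R : point) (v : point_hom Q R) (u : point_hom P Q) :
  pt_map R \o (v \o u) = pt_map P.
Proof. by rewrite compA !pt_over. Qed.

Lemma point_comp_under (P Q R : point) (v : point_hom Q R) (u : point_hom P Q) :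
  (v \o u) \o pt_sec P = pt_sec R.
Proof. by rewrite -compA !pt_under. Qed.

Definition point_comp (P Q R : point) (v : point_hom Q R) (u : point_hom P Q) :
  point_hom P R := PointHom (point_comp_over v u) (point_comp_under v u).

Lemma point_comp1m (P Q : point) (u : point_hom P Q) :
  point_comp (point_id Q) u = u.
Proof. by apply: point_hom_inj; exact: comp1m. Qed.

Lemma point_compm1 (P Q : point) (u : point_hom P Q) :
  point_comp u (point_id P) = u.
Proof. by apply: point_hom_inj; exact: compm1. Qed.

Lemma point_compA (P Q R S : point) (w : point_hom R S) (v : point_hom Q R)
    (u : point_hom P Q) :
  point_comp w (point_comp v u) = point_comp (point_comp w v) u.
Proof. by apply: point_hom_inj; exact: compA. Qed.

Definition Pt : category :=
  @Category point point_hom point_id point_comp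
    point_comp1m point_compm1 point_compA.

End Points.

Section ChangeOfBase.
Variables (C : category) (X Y : C) (h : hom X Y).
(* Only pullbacks along h are required, so that h may be the terminal map of an
   object in a category that merely has products. *)
Variable pb : forall (A : C) (f : hom A Y), pullback f h.

Section Objects.
Variable P : point Y.
Let B := pb (pt_map P).

Lemma cob_sec_comm : pt_map P \o (pt_sec P \o h) = h \o idm X.
Proof. by rewrite compA pt_split comp1m compm1. Qed.

Definition cob_obj : point X :=
  @Point C X (pb_obj B) (pb2 B) (pb_pair B cob_sec_comm)
    (pb_pair2 B cob_sec_comm).

End Objects.

Section Morphisms.
Variables (P Q : point Y) (u : point_hom P Q).
Let A := pb (pt_map P).
Let B := pb (pt_map Q).

Lemma cob_map_comm : pt_map Q \o (u \o pb1 A) = h \o pb2 A.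
Proof. by rewrite compA pt_over pb_comm. Qed.

Lemma cob_map_under :
  pb_pair B cob_map_comm \o pt_sec (cob_obj P) = pt_sec (cob_obj Q).
Proof.
by apply: pb_unique; rewrite compA /= !(pb_pair1, pb_pair2) // -compA pb_pair1
  compA pt_under.
Qed.

Definition cob_map : point_hom (cob_obj P) (cob_obj Q) :=
  @PointHom C X (cob_obj P) (cob_obj Q) (pb_pair B cob_map_comm)
    (pb_pair2 B cob_map_comm) cob_map_under.

End Morphisms.

Lemma cob_map1 (P : point Y) : cob_map (point_id P) = point_id (cob_obj P).
Proof.
by apply: point_hom_inj; apply: pb_unique;
  rewrite /= !(pb_pair1, pb_pair2) compm1 ?comp1m.
Qed.

Lemma cob_mapM (P Q R : point Y) (v : point_hom Q R) (u : point_hom P Q) :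
  cob_map (point_comp v u) = point_comp (cob_map v) (cob_map u).
Proof.
apply: point_hom_inj; apply: pb_unique; rewrite /= compA !(pb_pair1, pb_pair2) //.
by rewrite -[RHS]compA pb_pair1 compA.
Qed.

Definition change_of_base : functor (Pt Y) (Pt X) :=
  @Functor (Pt Y) (Pt X) cob_obj cob_map cob_map1 cob_mapM.

End ChangeOfBase.

(* tau_Y^* : Pt_1 D -> Pt_Y D; pulling A -> 1 back along tau_Y : Y -> 1 is
   forming the product of A and Y. *)
Definition terminal_change_of_base (D : category) (L : finite_products D)
    (Y : D) : functor (Pt (one (fp_one L))) (Pt Y) :=
  change_of_base (h := bang (fp_one L) Y)
    (fun A f => terminal_pullback f (bang (fp_one L) Y) (fp_prod L A Y)).

(* The choice of products is immaterial: different choices yield isomorphic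
   functors, up to the canonical isomorphism of the terminal objects. *)
Definition algebraically_cartesian_closed (D : category) : Prop :=
  exists L : finite_products D,
    forall Y : D, has_right_adjoint (terminal_change_of_base L Y).

Definition fiberwise_algebraically_cartesian_closed (C : category) : Prop :=
  finitely_complete C /\ forall Y : C, algebraically_cartesian_closed (Pt Y).

Record signature := Signature {
  op :> Type;
  arity : op -> nat }.

Inductive term (S : signature) (V : Type) : Type :=
| Var of V
| App (o : S) of ('I_(arity o) -> term S V).

Arguments Var {S V} _.
Arguments App {S V} o _.

Fixpoint subst (S : signature) (V W : Type) (s : V -> term S W)
    (t : term S V) : term S W :=
  match t with
  | Var x => s x
  | App o a => App o (fun i => subst s (a i))
  end.

Record theory := Theory {
  sig :> signature;
  identity : term sig nat -> term sig nat -> Prop }.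

(* Equality of terms modulo the theory: the least congruence containing every
   substitution instance of the identities of the theory. *)
Inductive provable (T : theory) (V : Type) : term T V -> term T V -> Prop :=
| prv_identity (l r : term T nat) (s : nat -> term T V) :
    identity l r -> provable (subst s l) (subst s r)
| prv_refl t : provable t t
| prv_sym t u : provable t u -> provable u t
| prv_trans t u v : provable t u -> provable u v -> provable t v
| prv_app (o : T) (a b : 'I_(arity o) -> term T V) :
    (forall i, provable (a i) (b i)) -> provable (App o a) (App o b).

Definition subst3 (S : signature) (V : Type) (p : term S 'I_3)
    (a b c : term S V) : term S V :=
  subst (fun i : 'I_3 => nth a [:: a; b; c] i) p.

(* The variables x and y are those indexed by true and false. *)
Definition malcev (T : theory) : Prop :=
  exists p : term T 'I_3,
    let x : term T bool := Var true in
    let y : term T bool := Var false in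
    provable (subst3 p x y y) x /\ provable (subst3 p x x y) y.

Definition operations (S : signature) (A : Type) :=
  forall o : S, ('I_(arity o) -> A) -> A.

Fixpoint eval (S : signature) (A : Type) (m : operations S A) (V : Type)
    (e : V -> A) (t : term S V) : A :=
  match t with
  | Var x => e x
  | App o a => m o (fun i => eval m e (a i))
  end.

Definition is_model (T : theory) (A : Type) (m : operations T A) : Prop :=
  forall l r : term T nat, identity l r -> forall e, eval m e l = eval m e r.

Definition is_hom (S : signature) (A B : Type) (m : operations S A)
    (n : operations S B) (f : A -> B) : Prop :=
  forall (o : S) (a : 'I_(arity o) -> A), f (m o a) = n o (fun i => f (a i)).

Lemma is_hom_id (S : signature) (A : Type) (m : operations S A) :
  is_hom m m (fun x => x).
Proof. by []. Qed.

Lemma is_hom_comp (S : signature) (A B D : Type) (m : operations S A)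
    (n : operations S B) (k : operations S D) (g : B -> D) (f : A -> B) :
  is_hom n k g -> is_hom m n f -> is_hom m k (fun x => g (f x)).
Proof. by move=> hg hf o a; rewrite hf hg. Qed.

Section Variety.
Variable T : theory.

Record algebra := Algebra {
  carrier :> Type;
  alg_op : operations T carrier;
  alg_model : is_model alg_op }.

Record alg_hom (A B : algebra) := AlgHom {
  alg_fun :> A -> B;
  alg_funP : is_hom (@alg_op A) (@alg_op B) alg_fun }.

Lemma alg_hom_inj (A B : algebra) (f g : alg_hom A B) :
  alg_fun f = alg_fun g -> f = g.
Proof.
case: f => f hf; case: g => g hg /= e; subst g.
by congr AlgHom; exact: Prop_irrelevance.
Qed.

Definition alg_id (A : algebra) : alg_hom A A := AlgHom (is_hom_id (@alg_op A)).

Definition alg_comp (A B D : algebra) (g : alg_hom B D) (f : alg_hom A B) :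
  alg_hom A D := AlgHom (is_hom_comp (alg_funP g) (alg_funP f)).

Lemma alg_comp1m (A B : algebra) (f : alg_hom A B) : alg_comp (alg_id B) f = f.
Proof. exact: alg_hom_inj. Qed.

Lemma alg_compm1 (A B : algebra) (f : alg_hom A B) : alg_comp f (alg_id A) = f.
Proof. exact: alg_hom_inj. Qed.

Lemma alg_compA (A B D E : algebra) (h : alg_hom D E) (g : alg_hom B D)
    (f : alg_hom A B) :
  alg_comp h (alg_comp g f) = alg_comp (alg_comp h g) f.
Proof. exact: alg_hom_inj. Qed.

Definition variety : category :=
  @Category algebra alg_hom alg_id alg_comp alg_comp1m alg_compm1 alg_compA.

End Variety.

Section TopologicalAlgebras.
Variable T : theory.

(* An n-ary operation is continuous for the product topology on its domain
   ({ptws 'I_n -> A}). The choice structure that is part of a topologicalType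
   is ignored by the morphisms, so it does not affect the category up to
   equivalence. *)
Record top_algebra := TopAlgebra {
  top_carrier :> topologicalType;
  top_op : operations T top_carrier;
  top_model : is_model top_op;
  top_op_continuous : forall o : T,
    continuous (top_op (o := o) :
      {ptws 'I_(arity o) -> top_carrier} -> top_carrier) }.

Record top_hom (A B : top_algebra) := TopHom {
  top_fun :> A -> B;
  top_funP : is_hom (@top_op A) (@top_op B) top_fun;
  top_fun_continuous : continuous top_fun }.

Lemma top_hom_inj (A B : top_algebra) (f g : top_hom A B) :
  top_fun f = top_fun g -> f = g.
Proof.
case: f => f hf cf; case: g => g hg cg /= e; subst g.
by congr TopHom; exact: Prop_irrelevance.
Qed.

Lemma top_id_continuous (A : top_algebra) : continuous (fun x : A => x).
Proof. by move=> x; exact: cvg_id. Qed.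

Definition top_id (A : top_algebra) : top_hom A A :=
  TopHom (is_hom_id (@top_op A)) (@top_id_continuous A).

Lemma top_comp_continuous (A B D : top_algebra) (g : top_hom B D)
    (f : top_hom A B) : continuous (fun x => g (f x)).
Proof.
by move=> x; apply: continuous_comp; exact: top_fun_continuous.
Qed.

Definition top_comp (A B D : top_algebra) (g : top_hom B D) (f : top_hom A B) :
    top_hom A D :=
  TopHom (is_hom_comp (top_funP g) (top_funP f)) (@top_comp_continuous _ _ _ g f).

Lemma top_comp1m (A B : top_algebra) (f : top_hom A B) :
  top_comp (top_id B) f = f.
Proof. exact: top_hom_inj. Qed.

Lemma top_compm1 (A B : top_algebra) (f : top_hom A B) :
  top_comp f (top_id A) = f.
Proof. exact: top_hom_inj. Qed.

Lemma top_compA (A B D E : top_algebra) (h : top_hom D E) (g : top_hom B D)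
    (f : top_hom A B) :
  top_comp h (top_comp g f) = top_comp (top_comp h g) f.
Proof. exact: top_hom_inj. Qed.

Definition topological_algebras : category :=
  @Category top_algebra top_hom top_id top_comp
    top_comp1m top_compm1 top_compA.

End TopologicalAlgebras.

(* Main.v *)
From mathcomp Require Import all_boot all_classical.
From mathcomp Require Import topology.
Require Import Defs.

Set Implicit Arguments.
Unset Strict Implicit.
Unset Printing Implicit Defensive.

Local Open Scope cat_scope.

(** Fix a Mal'cev term p.  Let (f, s) : X <-> Y be a split epimorphism, seen as
    an object X of the category of points over Y, and let (pi, sg) : Z <-> X be
    a point over X.  For a point (w, t) : W <-> Y, the product of W and X among
    the points over Y is the pullback of w and f, whose elements (a, x) satisfy
    w a = f x =: y.  In this pullback

      (a, x) = p ((a, s y), (t y, s y), (t y, x)),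

    so a morphism h from it to Z, over X and compatible with sg, is determined
    by its restriction k a = h (a, s (w a)) to W, namely

      h (a, x) = p (k a, sg (s y), sg x).

    Conversely, a morphism k : W -> Z of points over Y with pi k = s w extends
    in this way exactly when the right-hand side is a homomorphism in (a, x);
    such a k is called central below.  Hence the change of base functor along f
    has a right adjoint if and only if, for every Z, the functor sending W to
    the set of central morphisms W -> Z is representable, that is, has a
    universal element k0 : G -> Z ([fiberwise_central]).

    This equivalence uses only that pullbacks are computed on elements and that
    a homomorphism of the form x |-> p (u x, v x, w x) is a morphism as soon as
    u, v and w are; both hold for algebras and for topological algebras, the
    operation p being continuous in the latter ([malcev_concrete]).  Moreover
    centrality only concerns the underlying homomorphisms.  So let k0 : G -> Z
    be universal among the central homomorphisms into the underlying algebra of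
    a topological Z, and give G the initial topology along k0.  The operations
    and the structure maps of G are then continuous, since they are so after
    composition with k0 or factor through it; and if a continuous central k
    factors as k0 u, then u is continuous because k0 u is.  Thus k0 is universal
    among the continuous central homomorphisms ([central_lift_universal]). *)

(** * Terms and the Mal'cev operation *)

Lemma eval_subst (S : signature) (A V W : Type) (m : operations S A)
    (s : V -> term S W) (e : W -> A) (t : term S V) :
  eval m e (subst s t) = eval m (fun v => eval m e (s v)) t.
Proof. by elim: t => //= o a IH; congr (m o _); apply: funext. Qed.

Lemma hom_eval (S : signature) (A B V : Type) (m : operations S A)
    (n : operations S B) (f : A -> B) (e : V -> A) (t : term S V) :
  is_hom m n f -> f (eval m e t) = eval n (fun v => f (e v)) t.
Proof.
by move=> hf; elim: t => //= o a IH; rewrite hf; congr (n o _); apply: funext.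
Qed.

Lemma provable_sound (T : theory) (A : algebra T) (V : Type) (t u : term T V)
    (e : V -> A) :
  provable t u -> eval (@alg_op _ A) e t = eval (@alg_op _ A) e u.
Proof.
elim=> {t u}.
- by move=> l r s lr; rewrite !eval_subst; apply: alg_model.
- by [].
- by move=> t u _ ->.
- by move=> t u v _ -> _ ->.
- by move=> o a b _ IH /=; congr (alg_op _); apply: funext.
Qed.

Definition malcev_op (S : signature) (A : Type) (m : operations S A)
    (p : term S 'I_3) (a b c : A) : A :=
  eval m (fun i : 'I_3 => nth a [:: a; b; c] i) p.

Lemma eval_subst3 (S : signature) (A V : Type) (m : operations S A)
    (e : V -> A) (p : term S 'I_3) (t u v : term S V) :
  eval m e (subst3 p t u v) =
  malcev_op m p (eval m e t) (eval m e u) (eval m e v).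
Proof.
rewrite eval_subst /malcev_op; congr (eval _ _ _).
by apply: funext; case=> [[|[|[|]]]].
Qed.

Lemma hom_malcev (S : signature) (A B : Type) (m : operations S A)
    (n : operations S B) (p : term S 'I_3) (f : A -> B) (a b c : A) :
  is_hom m n f -> f (malcev_op m p a b c) = malcev_op n p (f a) (f b) (f c).
Proof.
move=> hf; rewrite /malcev_op (hom_eval _ _ hf); congr (eval _ _ _).
by apply: funext; case=> [[|[|[|]]]].
Qed.

Definition malcev_term (T : theory) (p : term T 'I_3) : Prop :=
  let x : term T bool := Var true in
  let y : term T bool := Var false in
  provable (subst3 p x y y) x /\ provable (subst3 p x x y) y.

Section MalcevLaws.
Variables (T : theory) (p : term T 'I_3) (A : algebra T).
Hypothesis mp : malcev_term p.

Lemma malcev_opr (a b : A) : malcev_op (@alg_op _ A) p a b b = a.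
Proof.
have := provable_sound (fun c : bool => if c then a else b) (proj1 mp).
by rewrite eval_subst3.
Qed.

Lemma malcev_opl (a b : A) : malcev_op (@alg_op _ A) p a a b = b.
Proof.
have := provable_sound (fun c : bool => if c then a else b) (proj2 mp).
by rewrite eval_subst3.
Qed.

End MalcevLaws.

(** * Pullbacks of algebras *)

Section PullbackAlgebra.
Variables (T : theory) (A B E : algebra T) (f : alg_hom A E) (g : alg_hom B E).

Definition pullback_carrier : Type := {ab : A * B | f ab.1 = g ab.2}.

Lemma pullback_op_subproof (o : T) (z : 'I_(arity o) -> pullback_carrier) :
  f (alg_op (fun i => (sval (z i)).1)) = g (alg_op (fun i => (sval (z i)).2)).
Proof.
rewrite !alg_funP; congr (alg_op _); apply: funext => i; exact: svalP (z i).
Qed.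

Definition pullback_op : operations T pullback_carrier := fun o z =>
  exist _ (alg_op (fun i => (sval (z i)).1), alg_op (fun i => (sval (z i)).2))
    (pullback_op_subproof z).

Lemma pullback_eq (z z' : pullback_carrier) :
  (sval z).1 = (sval z').1 -> (sval z).2 = (sval z').2 -> z = z'.
Proof.
case: z z' => [[a b] e] [[a' b'] e'] /= ea eb.
by apply: eq_exist; rewrite ea eb.
Qed.

Lemma pullback_model : is_model pullback_op.
Proof.
move=> l r lr e.
have h1 : is_hom pullback_op (@alg_op _ A) (fun z => (sval z).1) by [].
have h2 : is_hom pullback_op (@alg_op _ B) (fun z => (sval z).2) by [].
by apply: pullback_eq; [rewrite !(hom_eval _ _ h1)|rewrite !(hom_eval _ _ h2)];
  apply: alg_model.
Qed.

Definition pullback_algebra : algebra T := Algebra pullback_model.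

Definition pullback_fst : alg_hom pullback_algebra A :=
  @AlgHom T pullback_algebra A (fun z => (sval z).1) (fun o a => erefl).

Definition pullback_snd : alg_hom pullback_algebra B :=
  @AlgHom T pullback_algebra B (fun z => (sval z).2) (fun o a => erefl).

Section Pair.
Variables (W : algebra T) (u : alg_hom W A) (v : alg_hom W B).
Hypothesis e : forall x, f (u x) = g (v x).

Lemma pullback_pair_hom : is_hom (@alg_op _ W) (@alg_op _ pullback_algebra)
  (fun x => exist _ (u x, v x) (e x) : pullback_algebra).
Proof. by move=> o a; apply: pullback_eq; rewrite /= alg_funP. Qed.

Definition pullback_pair : alg_hom W pullback_algebra :=
  AlgHom pullback_pair_hom.

End Pair.
End PullbackAlgebra.

(** * Initial topologies *)

Section InitialFamily.
Local Open Scope classical_set_scope.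
Variables (S : choiceType) (I : Type) (A : I -> topologicalType).
Variable j : forall i, S -> A i.

(** The coarsest topology on S for which every j i is continuous; the topology
    of pointwise convergence is the case of the evaluation maps. *)
Definition initial_family : topologicalType :=
  sup_topology (fun i => Topological.class (initial_topology (j i))).

Lemma initial_family_proj i : continuous (j i : initial_family -> A i).
Proof.
move=> x; have /cvg_sup/(_ i) h :
  nbhs (x : initial_family) --> (x : initial_family) by exact: cvg_id.
apply: cvg_trans (@initial_continuous S (A i) (j i) x).
exact: cvg_app h.
Qed.

Lemma initial_family_continuous (W : topologicalType) (u : W -> S) :
  (forall i, continuous (fun x => j i (u x))) ->
  continuous (u : W -> initial_family).
Proof.
move=> uc x; apply/cvg_sup => i N /=.
rewrite (@nbhsE (initial_topology (j i))) => -[_ [[V oV <-] Vx] VN].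
have {Vx} Vx : nbhs x (u @^-1` (j i @^-1` V)).
  exact: uc i x V (open_nbhs_nbhs (conj oV Vx)).
exact: (@filterS _ _ _ (u @^-1` (j i @^-1` V))) (fun y => VN (u y)) Vx.
Qed.

End InitialFamily.

Lemma ptws_proj_continuous (I : Type) (A : topologicalType) (i : I) :
  continuous (fun a : {ptws I -> A} => a i).
Proof.
exact: (@initial_family_proj _ _ _ (fun i (a : I -> A) => a i) i).
Qed.

Lemma ptws_continuous (I : Type) (W A : topologicalType) (u : W -> I -> A) :
  (forall i, continuous (fun x => u x i)) ->
  continuous (u : W -> {ptws I -> A}).
Proof.
exact: (@initial_family_continuous _ _ _ (fun i (a : I -> A) => a i) W u).
Qed.


(** * Initial lifts of algebras and limits of topological algebras *)

Definition top_forget_obj (T : theory) (A : top_algebra T) : algebra T :=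
  Algebra (@top_model T A).

Definition top_forget (T : theory) :
    functor (topological_algebras T) (variety T) :=
  @Functor (topological_algebras T) (variety T) (@top_forget_obj T)
    (fun A B f => @AlgHom T (top_forget_obj A) (top_forget_obj B)
                    (top_fun f) (top_funP f))
    (fun A => erefl) (fun A B E g f => erefl).

(** An algebra with homomorphisms to topological algebras becomes a topological
    algebra for the initial topology, because these homomorphisms commute with
    the operations.  The empty family yields the terminal object, two
    projections yield pullbacks, and a single homomorphism yields the topology
    put on a universal central object. *)
Section InitialLift.
Variables (T : theory) (Q : algebra T) (I : Type) (A : I -> top_algebra T).
Variable j : forall i, alg_hom Q (top_forget_obj (A i)).

Definition initial_lift_space : topologicalType :=
  initial_family (fun i (x : {classic Q}) => j i x : A i).

Definition initial_lift_op : operations T initial_lift_space := @alg_op T Q.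

Lemma initial_lift_op_continuous (o : T) :
  continuous (@initial_lift_op o :
    {ptws 'I_(arity o) -> initial_lift_space} -> initial_lift_space).
Proof.
apply: initial_family_continuous => i /=.
rewrite (_ : (fun a => _) = @top_op _ (A i) o \o (fun a k => j i (a k)))%FUN;
  last by apply: funext => a; rewrite /= /initial_lift_op alg_funP.
move=> a; apply: (@continuous_comp {ptws 'I_(arity o) -> initial_lift_space}
  {ptws 'I_(arity o) -> A i} _ (fun a k => j i (a k)) (@top_op _ (A i) o));
  last exact: top_op_continuous.
apply: ptws_continuous => k b.
apply: (@continuous_comp {ptws 'I_(arity o) -> initial_lift_space}
  initial_lift_space (A i) (fun a => a k) (j i)).
  exact: ptws_proj_continuous.
exact: (@initial_family_proj _ _ _ (fun i (x : {classic Q}) => j i x : A i)).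
Qed.

Definition initial_lift : top_algebra T :=
  @TopAlgebra T initial_lift_space initial_lift_op (@alg_model T Q)
    initial_lift_op_continuous.

Definition initial_lift_proj (i : I) : top_hom initial_lift (A i) :=
  @TopHom T initial_lift (A i) (j i) (alg_funP (j i))
    (@initial_family_proj _ _ _ (fun i (x : {classic Q}) => j i x : A i) i).

Definition initial_lift_hom (W : top_algebra T)
    (u : alg_hom (top_forget_obj W) Q)
    (uc : forall i, continuous (fun x : W => j i (u x) : A i)) :
    top_hom W initial_lift :=
  @TopHom T W initial_lift u (alg_funP u)
    (@initial_family_continuous _ _ _
       (fun i (x : {classic Q}) => j i x : A i) W u uc).

End InitialLift.

Lemma eval_continuous (T : theory) (A : topologicalType) (B : top_algebra T)
    (V : Type) (e : V -> A -> B) (t : term T V) :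
  (forall v, continuous (e v)) ->
  continuous (fun x => eval (@top_op _ B) (fun v => e v x) t).
Proof.
move=> ec; elim: t => [v|o a IH] /=; first exact: ec.
move=> x; apply: (@continuous_comp _ {ptws 'I_(arity o) -> B} _
  (fun y i => eval (@top_op _ B) (fun v => e v y) (a i)) (@top_op _ B o)).
  exact: ptws_continuous.
exact: top_op_continuous.
Qed.

Lemma malcev_op_continuous (T : theory) (p : term T 'I_3) (A : topologicalType)
    (B : top_algebra T) (u v w : A -> B) :
  continuous u -> continuous v -> continuous w ->
  continuous (fun x => malcev_op (@top_op _ B) p (u x) (v x) (w x)).
Proof.
move=> uc vc wc; pose e (i : 'I_3) := nth u [:: u; v; w] i.
have ec i : continuous (e i) by case: i => [[|[|[|]]]].
rewrite (_ : (fun x => _) = fun x => eval (@top_op _ B) (fun i => e i x) p).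
  exact: eval_continuous.
apply: funext => x; congr (eval _ _ _).
by apply: funext; case=> [[|[|[|]]]].
Qed.

(** * Categories of algebras with a Mal'cev operation *)

Section Elements.
Variables (T : theory) (C : category) (U : functor C (variety T)).

Definition el (X : C) : algebra T := fobj U X.

Definition act (X Z : C) (f : hom X Z) : alg_hom (el X) (el Z) := fmap U f.

Lemma act_comp (X Z W : C) (g : hom Z W) (f : hom X Z) (x : el X) :
  act (g \o f) x = act g (act f x).
Proof. by rewrite /act fmapM. Qed.

Lemma act_id (X : C) (x : el X) : act (idm X) x = x.
Proof. by rewrite /act fmap1. Qed.

End Elements.

(** What algebras and topological algebras have in common and what the
    description of right adjoints by central morphisms relies on.  The last
    condition replaces continuity: a homomorphism that is pointwise p applied to
    three morphisms is itself (the image of) a morphism. *)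
Record malcev_concrete (T : theory) (p : term T 'I_3) (C : category)
    (U : functor C (variety T)) : Prop := MalcevConcrete {
  mc_faithful : forall (X Z : C) (f g : hom X Z),
    (forall x, act U f x = act U g x) -> f = g;
  mc_one : inhabited (terminal C);
  mc_pullback : forall (X Z W : C) (f : hom X W) (g : hom Z W),
    exists P : pullback f g,
      (forall z z', act U (pb1 P) z = act U (pb1 P) z' ->
         act U (pb2 P) z = act U (pb2 P) z' -> z = z') /\
      (forall a b, act U f a = act U g b ->
         exists z, act U (pb1 P) z = a /\ act U (pb2 P) z = b);
  mc_lift : forall (X Z : C) (u v w : hom X Z) (h : alg_hom (el U X) (el U Z)),
    (forall x, h x =
       malcev_op (@alg_op T (el U Z)) p (act U u x) (act U v x) (act U w x)) ->
    exists h' : hom X Z, forall x, act U h' x = h x }.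

Definition identity_functor (C : category) : functor C C :=
  @Functor C C (fun X => X) (fun X Y f => f) (fun X => erefl)
    (fun X Y Z g f => erefl).

Lemma unit_model (T : theory) : @is_model T unit (fun _ _ => tt).
Proof. by move=> l r _ e; rewrite [LHS]unitE [RHS]unitE. Qed.

Definition unit_algebra (T : theory) : algebra T := Algebra (@unit_model T).

Lemma unit_algebraP (T : theory) (x y : unit_algebra T) : x = y.
Proof. exact: etrans (unitE x) (esym (unitE y)). Qed.

Definition to_unit_algebra (T : theory) (A : algebra T) :
  alg_hom A (unit_algebra T) :=
  @AlgHom T A (unit_algebra T) (fun _ => tt) (fun o a => erefl).

Lemma variety_malcev_concrete (T : theory) (p : term T 'I_3) :
  malcev_concrete p (identity_functor (variety T)).
Proof.
split.
- by move=> X Z f g fg; apply: alg_hom_inj; apply: funext.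
- constructor; apply: (@Terminal (variety T) _ (@to_unit_algebra T)) => X u v.
  by apply: alg_hom_inj; apply: funext => x; exact: unit_algebraP.
- move=> X Z W f g.
  unshelve eexists.
    apply: (@Pullback (variety T) X Z W f g (pullback_algebra f g)
      (pullback_fst f g) (pullback_snd f g) _
      (fun V a b e =>
         pullback_pair (fun x => congr1 (fun h => alg_fun h x) e))).
    + by apply: alg_hom_inj; apply: funext => z; exact: svalP z.
    + by move=> V a b e; apply: alg_hom_inj.
    + by move=> V a b e; apply: alg_hom_inj.
    + move=> V u v e1 e2; apply: alg_hom_inj; apply: funext => x.
      apply: pullback_eq; first exact: (congr1 (fun h => alg_fun h x) e1).
      exact: (congr1 (fun h => alg_fun h x) e2).
  split=> [z z'|a b e] /=; first exact: pullback_eq.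
  by exists (exist _ (a, b) e).
- by move=> X Z u v w h _; exists h.
Qed.

Section TopologicalPullback.
Variables (T : theory) (A B E : top_algebra T).
Variables (f : top_hom A E) (g : top_hom B E).

Let fU : alg_hom (top_forget_obj A) (top_forget_obj E) := fmap (top_forget T) f.
Let gU : alg_hom (top_forget_obj B) (top_forget_obj E) := fmap (top_forget T) g.
Let side (b : bool) : top_algebra T := if b then A else B.
Let proj (b : bool) :
    alg_hom (pullback_algebra fU gU) (top_forget_obj (side b)) :=
  match b with true => pullback_fst fU gU | false => pullback_snd fU gU end.

Definition top_pullback_obj : top_algebra T := initial_lift proj.

Definition top_pullback_fst : top_hom top_pullback_obj A :=
  initial_lift_proj proj true.

Definition top_pullback_snd : top_hom top_pullback_obj B :=
  initial_lift_proj proj false.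

Definition top_pullback_pair (W : top_algebra T) (u : top_hom W A)
    (v : top_hom W B) (e : forall x, f (u x) = g (v x)) :
    top_hom W top_pullback_obj :=
  @initial_lift_hom T _ bool side proj W
    (@pullback_pair T _ _ _ fU gU (top_forget_obj W)
       (fmap (top_forget T) u) (fmap (top_forget T) v) e)
    (fun b => match b with
              | true => @top_fun_continuous _ _ _ u
              | false => @top_fun_continuous _ _ _ v
              end).

Definition top_pullback : @pullback (topological_algebras T) A B E f g.
Proof.
apply: (@Pullback (topological_algebras T) A B E f g top_pullback_obj
  top_pullback_fst top_pullback_snd _
  (fun V a b e =>
     top_pullback_pair (fun x => congr1 (fun h => top_fun h x) e))).
- by apply: top_hom_inj; apply: funext => z; exact: svalP z.
- by move=> V a b e; apply: top_hom_inj.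
- by move=> V a b e; apply: top_hom_inj.
- move=> V u v e1 e2; apply: top_hom_inj; apply: funext => x.
  apply: (@pullback_eq T _ _ _ fU gU).
    exact: (congr1 (fun h => top_fun h x) e1).
  exact: (congr1 (fun h => top_fun h x) e2).
Defined.

End TopologicalPullback.

Lemma topological_malcev_concrete (T : theory) (p : term T 'I_3) :
  malcev_concrete p (top_forget T).
Proof.
split.
- by move=> X Z f g fg; apply: top_hom_inj; apply: funext.
- pose A (i : void) : top_algebra T := match i with end.
  pose j i : alg_hom (unit_algebra T) (top_forget_obj (A i)) :=
    match i with end.
  pose bang (X : top_algebra T) : top_hom X (initial_lift j) :=
    @initial_lift_hom T _ _ _ j X (to_unit_algebra _)
      (fun i => match i with end).
  constructor; apply: (@Terminal (topological_algebras T) _ bang) => X u v.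
  by apply: top_hom_inj; apply: funext => x; exact: unit_algebraP.
- move=> X Z W f g; exists (top_pullback f g).
  split=> [z z'|a b e] /=.
    exact: (@pullback_eq T _ _ _ (fmap (top_forget T) f)
              (fmap (top_forget T) g)).
  by exists (exist _ (a, b) e).
- move=> X Z u v w h hE.
  have hc : continuous (alg_fun h : top_carrier X -> top_carrier Z).
    rewrite (_ : alg_fun h = (fun x =>
      malcev_op (@top_op _ Z) p (top_fun u x) (top_fun v x) (top_fun w x))).
      by apply: malcev_op_continuous; exact: top_fun_continuous.
    by apply: funext.
  by exists (@TopHom T X Z h (alg_funP h) hc).
Qed.

(** * Right adjoints and universal arrows *)

Definition universal_arrow (C D : category) (F : functor C D) (B : D) (G : C)
    (e : hom (F G) B) : Prop :=
  forall (A : C) (h : hom (F A) B), exists! u : hom A G, e \o fmap F u = h.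

Lemma right_adjoint_universal (C D : category) (F : functor C D) :
  has_right_adjoint F -> forall B : D, exists G (e : hom (F G) B),
    universal_arrow e.
Proof.
move=> [G [[phi bij natl _]]] B; exists (G B).
have [psi phiK psiK] := bij (G B) B.
exists (psi (idm _)) => A h.
have phiE u : phi A B (psi (idm _) \o fmap F u) = u.
  by rewrite natl psiK comp1m.
exists (phi _ _ h); split; last by move=> v <-; rewrite phiE.
by apply: (bij_inj (bij A B)); rewrite phiE.
Qed.

Lemma universal_right_adjoint (C D : category) (F : functor C D) :
  (forall B : D, exists G (e : hom (F G) B), universal_arrow e) ->
  has_right_adjoint F.
Proof.
move=> univ.
pose G B := projT1 (cid (univ B)).
pose e B : hom (F (G B)) B := projT1 (cid (projT2 (cid (univ B)))).
have eU B : universal_arrow (e B) := projT2 (cid (projT2 (cid (univ B)))).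
pose tr A B (h : hom (F A) B) : hom A (G B) := projT1 (cid (eU B A h)).
have trE A B (h : hom (F A) B) : e B \o fmap F (tr A B h) = h.
  by rewrite /tr; case: cid => u [].
have trU A B (h : hom (F A) B) u : e B \o fmap F u = h -> tr A B h = u.
  by rewrite /tr; case: cid => v /= [_ vU]; exact: vU.
have Gid B : tr (G B) B (idm B \o e B) = idm (G B).
  by apply: trU; rewrite fmap1 compm1 comp1m.
have Gcomp A B E (g : hom B E) (f : hom A B) :
    tr _ E ((g \o f) \o e A) = tr _ E (g \o e B) \o tr _ B (f \o e A).
  by apply: trU; rewrite fmapM compA trE -compA trE compA.
pose GF := @Functor D C G (fun A B f => tr (G A) B (f \o e A)) Gid Gcomp.
exists GF; constructor; apply: (@Adjunction C D F GF tr) => /=.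
- move=> A B; exists (fun u => e B \o fmap F u) => [h|u]; first exact: trE.
  exact: trU.
- by move=> A' A B u k; apply: trU; rewrite fmapM compA trE.
- by move=> A B B' v k; apply: trU; rewrite fmapM compA trE -compA trE.
Qed.

(** * Points over an object *)

Section PointProducts.
Variables (C : category) (Y : C).

(** Points over Y form a pointed category, with the identity of Y as zero
    object. *)
Definition zero_point : Pt Y := @Point C Y Y (idm Y) (idm Y) (comp1m (idm Y)).

Definition zero_point_terminal : terminal (Pt Y).
Proof.
apply: (@Terminal (Pt Y) zero_point (fun X : point Y =>
  @PointHom C Y X zero_point (pt_map X) (comp1m _) (pt_split X))) => X u v.
apply: point_hom_inj.
by have := pt_over u; have := pt_over v; rewrite /= !comp1m => -> ->.
Defined.

Lemma zero_hom_over (W X : point Y) :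
  pt_map X \o (pt_sec X \o pt_map W) = pt_map W.
Proof. by rewrite compA pt_split comp1m. Qed.

Lemma zero_hom_under (W X : point Y) :
  (pt_sec X \o pt_map W) \o pt_sec W = pt_sec X.
Proof. by rewrite -compA pt_split compm1. Qed.

Definition zero_hom (W X : Pt Y) : hom W X :=
  PointHom (zero_hom_over W X) (zero_hom_under W X).

Lemma zero_compl (V W X : Pt Y) (u : hom W X) :
  u \o zero_hom V W = zero_hom V X.
Proof. by apply: point_hom_inj; rewrite /= compA pt_under. Qed.

Lemma zero_compr (V W X : Pt Y) (u : hom V W) :
  zero_hom W X \o u = zero_hom V X.
Proof. by apply: point_hom_inj; rewrite /= -compA pt_over. Qed.

(** A morphism out of any terminal object of points is the zero morphism, since
    the identity of that object is zero. *)
Lemma terminal_zero (t : terminal (Pt Y)) (W : Pt Y) (u : hom (one t) W) :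
  u = zero_hom (one t) W.
Proof.
by rewrite -(zero_compl _ u) (bang_unique (zero_hom _ _) (idm _)) compm1.
Qed.

(** The product of two points over Y is their pullback over Y. *)
Section FromPullback.
Variables (W X : point Y) (P : pullback (pt_map W) (pt_map X)).

Lemma pb_point_comm : pt_map W \o pt_sec W = pt_map X \o pt_sec X.
Proof. by rewrite !pt_split. Qed.

Lemma pb_point_split :
  (pt_map W \o pb1 P) \o pb_pair P pb_point_comm = idm Y.
Proof. by rewrite -compA pb_pair1 pt_split. Qed.

Definition pb_point : Pt Y := Point pb_point_split.

Definition pb_point_fst : hom pb_point W :=
  @PointHom C Y pb_point W (pb1 P) erefl (pb_pair1 _ _).

Definition pb_point_snd : hom pb_point X :=
  @PointHom C Y pb_point X (pb2 P) (esym (pb_comm P)) (pb_pair2 _ _).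

Section Pair.
Variables (V : point Y) (u : point_hom V W) (v : point_hom V X).

Lemma pb_point_pair_comm : pt_map W \o u = pt_map X \o v.
Proof. by rewrite !pt_over. Qed.

Lemma pb_point_pair_over :
  pt_map pb_point \o pb_pair P pb_point_pair_comm = pt_map V.
Proof. by rewrite /= -compA pb_pair1 pt_over. Qed.

Lemma pb_point_pair_under :
  pb_pair P pb_point_pair_comm \o pt_sec V = pt_sec pb_point.
Proof. by apply: pb_unique; rewrite compA !(pb_pair1, pb_pair2) pt_under. Qed.

Definition pb_point_pair : hom (V : Pt Y) pb_point :=
  PointHom pb_point_pair_over pb_point_pair_under.

End Pair.

Definition pb_product : product (W : Pt Y) (X : Pt Y).
Proof.
apply: (@Product (Pt Y) W X pb_point pb_point_fst pb_point_snd pb_point_pair).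
- by move=> V a b; apply: point_hom_inj; exact: pb_pair1.
- by move=> V a b; apply: point_hom_inj; exact: pb_pair2.
- move=> V u v e1 e2; apply: point_hom_inj; apply: (pb_unique (p := P)).
    exact: (congr1 (fun h => pt_fun h) e1).
  exact: (congr1 (fun h => pt_fun h) e2).
Defined.

End FromPullback.

Definition point_finite_products
    (pb : forall (W X E : C) (f : hom W E) (g : hom X E), pullback f g) :
    finite_products (Pt Y) :=
  @FiniteProducts (Pt Y) zero_point_terminal
    (fun W X => pb_product (pb _ _ _ (pt_map W) (pt_map X))).

End PointProducts.

Section PointFunctor.
Variables (C C' : category) (U : functor C C') (Y : C).

Lemma fpoint_split (X : point Y) :
  fmap U (pt_map X) \o fmap U (pt_sec X) = idm (U Y).
Proof. by rewrite -fmapM pt_split fmap1. Qed.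

Definition fpoint (X : point Y) : point (U Y) := Point (fpoint_split X).

Lemma fpoint_over (W X : point Y) (u : point_hom W X) :
  pt_map (fpoint X) \o fmap U u = pt_map (fpoint W).
Proof. by rewrite -fmapM pt_over. Qed.

Lemma fpoint_under (W X : point Y) (u : point_hom W X) :
  fmap U u \o pt_sec (fpoint W) = pt_sec (fpoint X).
Proof. by rewrite -fmapM pt_under. Qed.

Definition fpoint_hom (W X : point Y) (u : point_hom W X) :
  point_hom (fpoint W) (fpoint X) :=
  @PointHom C' (U Y) (fpoint W) (fpoint X) (fmap U u)
    (fpoint_over u) (fpoint_under u).

Lemma fpoint_hom1 (W : point Y) : fpoint_hom (point_id W) = point_id (fpoint W).
Proof. by apply: point_hom_inj; rewrite /= fmap1. Qed.

Lemma fpoint_homM (W X Z : point Y) (v : point_hom X Z) (u : point_hom W X) :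
  fpoint_hom (point_comp v u) = point_comp (fpoint_hom v) (fpoint_hom u).
Proof. by apply: point_hom_inj; rewrite /= fmapM. Qed.

Definition point_functor : functor (Pt Y) (Pt (U Y)) :=
  @Functor (Pt Y) (Pt (U Y)) fpoint fpoint_hom fpoint_hom1 fpoint_homM.

End PointFunctor.

(** * Central homomorphisms *)

Section Central.
Variables (T : theory) (p : term T 'I_3) (W X Y Z : algebra T).
Variables (w : W -> Y) (f : X -> Y) (s : Y -> X) (pi : Z -> X) (sg : X -> Z).
Variable k : W -> Z.

(** The only candidate for the value at (a, x) of an extension of k to the
    pullback of w and f that agrees with sg on X. *)
Definition malcev_extension (a : W) (x : X) : Z :=
  malcev_op (@alg_op _ Z) p (k a) (sg (s (f x))) (sg x).

(** The second condition says that [malcev_extension] is a homomorphism on the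
    pullback of w and f, stated without forming that pullback. *)
Definition central : Prop :=
  (forall a, pi (k a) = s (w a)) /\
  forall (o : T) (a : 'I_(arity o) -> W) (x : 'I_(arity o) -> X),
    (forall i, w (a i) = f (x i)) ->
    malcev_extension (alg_op a) (alg_op x) =
    alg_op (fun i => malcev_extension (a i) (x i)).

End Central.

(** The homomorphisms underlying a morphism of points over Y, and the structure
    maps of such a point. *)
Definition pact (T : theory) (C : category) (U : functor C (variety T)) (Y : C)
    (W X : Pt Y) (u : hom W X) : alg_hom (el U (pt_obj W)) (el U (pt_obj X)) :=
  act U (pt_fun u).

Definition pact_base (T : theory) (C : category) (U : functor C (variety T))
    (Y : C) (W : Pt Y) : alg_hom (el U (pt_obj W)) (el U Y) :=
  act U (pt_map W).

Definition pact_sec (T : theory) (C : category) (U : functor C (variety T))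
    (Y : C) (W : Pt Y) : alg_hom (el U Y) (el U (pt_obj W)) :=
  act U (pt_sec W).

Definition central_hom (T : theory) (p : term T 'I_3) (C : category)
    (U : functor C (variety T)) (Y : C) (X : Pt Y) (B : point X) (W : Pt Y)
    (k : hom W (pt_obj B)) : Prop :=
  central p (pact_base U W) (pact_base U X) (pact_sec U X)
    (pact U (pt_map B)) (pact U (pt_sec B)) (pact U k).

Definition universal_central (T : theory) (p : term T 'I_3) (C : category)
    (U : functor C (variety T)) (Y : C) (X : Pt Y) (B : point X) (G : Pt Y)
    (k0 : hom G (pt_obj B)) : Prop :=
  central_hom p U k0 /\
  forall (W : Pt Y) (k : hom W (pt_obj B)), central_hom p U k ->
    exists! u : hom W G, k0 \o u = k.

Section Classification.
Variables (T : theory) (p : term T 'I_3) (mp : malcev_term p).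
Variables (C : category) (U : functor C (variety T)).
Hypothesis mc : malcev_concrete p U.
Variable Y : C.

Lemma pact_comp (V W X : Pt Y) (v : hom W X) (u : hom V W) x :
  pact U (v \o u) x = pact U v (pact U u x).
Proof. exact: act_comp. Qed.

Lemma pact_faithful (W X : Pt Y) (u v : hom W X) :
  (forall x, pact U u x = pact U v x) -> u = v.
Proof. by move=> uv; apply: point_hom_inj; exact: (mc_faithful mc). Qed.

Lemma pact_over (W X : Pt Y) (u : hom W X) x :
  pact_base U X (pact U u x) = pact_base U W x.
Proof. by rewrite -[LHS]act_comp pt_over. Qed.

Lemma pact_under (W X : Pt Y) (u : hom W X) y :
  pact U u (pact_sec U W y) = pact_sec U X y.
Proof. by rewrite -[LHS]act_comp pt_under. Qed.

Lemma pact_split (W : Pt Y) y : pact_base U W (pact_sec U W y) = y.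
Proof. by rewrite -[LHS]act_comp pt_split act_id. Qed.

Lemma pact_id (W : Pt Y) x : pact U (idm W) x = x.
Proof. exact: act_id. Qed.

Lemma pact_zero (W X : Pt Y) x :
  pact U (zero_hom W X) x = pact_sec U X (pact_base U W x).
Proof. exact: act_comp. Qed.

Section Product.
Variables (W X : Pt Y) (P : product W X).

(** Any product of points, however it is chosen, is isomorphic to the pullback
    whose elements are pairs, so its elements are pairs as well. *)
Lemma product_pullback_elements :
  (forall z z', pact U (prod1 P) z = pact U (prod1 P) z' ->
     pact U (prod2 P) z = pact U (prod2 P) z' -> z = z') /\
  (forall a x, pact_base U W a = pact_base U X x ->
     exists z, pact U (prod1 P) z = a /\ pact U (prod2 P) z = x).
Proof.
have [B [Binj Bsurj]] := mc_pullback mc (pt_map W) (pt_map X).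
pose Q := pb_product B.
pose th : hom (prod_obj Q) (prod_obj P) := prod_pair P (prod1 Q) (prod2 Q).
pose ka : hom (prod_obj P) (prod_obj Q) := prod_pair Q (prod1 P) (prod2 P).
have thka : th \o ka = idm (prod_obj P).
  by apply: prod_unique; rewrite compA compm1 !(prod_pair1, prod_pair2).
split=> [z z' e1 e2|a x /Bsurj[z [z1 z2]]].
  suff e : pact U ka z = pact U ka z'.
    by rewrite -[z]pact_id -thka pact_comp e -pact_comp thka pact_id.
  apply: Binj.
    by rewrite -[LHS](pact_comp (prod1 Q)) -[RHS](pact_comp (prod1 Q))
      prod_pair1.
  by rewrite -[LHS](pact_comp (prod2 Q)) -[RHS](pact_comp (prod2 Q))
      prod_pair2.
by exists (pact U th z); rewrite -!pact_comp prod_pair1 prod_pair2.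
Qed.


Lemma pact_pair1 (V : Pt Y) (u : hom V W) (v : hom V X) t :
  pact U (prod1 P) (pact U (prod_pair P u v) t) = pact U u t.
Proof. by rewrite -pact_comp prod_pair1. Qed.

Lemma pact_pair2 (V : Pt Y) (u : hom V W) (v : hom V X) t :
  pact U (prod2 P) (pact U (prod_pair P u v) t) = pact U v t.
Proof. by rewrite -pact_comp prod_pair2. Qed.

Variable B : point X.

(** These h are the morphisms of points over X to B from the product of W and X,
    with section given by the zero morphism X -> W. *)
Definition product_hom (h : hom (prod_obj P) (pt_obj B)) : Prop :=
  pt_map B \o h = prod2 P /\
  h \o prod_pair P (zero_hom X W) (idm X) = pt_sec B.

Definition restriction (h : hom (prod_obj P) (pt_obj B)) : hom W (pt_obj B) :=
  h \o prod_pair P (idm W) (zero_hom W X).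

Let ext (k : hom W (pt_obj B)) :=
  malcev_extension p (pact_base U X) (pact_sec U X) (pact U (pt_sec B))
    (pact U k).

(** Every pair (a, x) over y is p ((a, s y), (t y, s y), (t y, x)), where h is
    known at the three arguments: it is the restriction of h at the first and
    the section of B at the two others. *)
Lemma product_hom_extension (h : hom (prod_obj P) (pt_obj B)) z :
  product_hom h ->
  pact U h z = ext (restriction h) (pact U (prod1 P) z) (pact U (prod2 P) z).
Proof.
move=> [h2 hs]; set a := pact U (prod1 P) z; set x := pact U (prod2 P) z.
have ax : pact_base U W a = pact_base U X x by rewrite !pact_over.
pose z1 := pact U (prod_pair P (idm W) (zero_hom W X)) a.
pose i2 := prod_pair P (zero_hom X W) (idm X).
pose x0 := pact_sec U X (pact_base U X x).
have -> : z = malcev_op (@alg_op _ _) p z1 (pact U i2 x0) (pact U i2 x).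
  apply: (proj1 product_pullback_elements).
    rewrite (hom_malcev _ _ _ _ (@alg_funP _ _ _ _)) !pact_pair1.
    by rewrite pact_id !pact_zero pact_split malcev_opr.
  rewrite (hom_malcev _ _ _ _ (@alg_funP _ _ _ _)) !pact_pair2.
  by rewrite pact_zero !pact_id ax malcev_opl.
rewrite (hom_malcev _ _ _ _ (@alg_funP _ _ _ _)) /ext /malcev_extension -hs.
by rewrite -/x0 /z1 /restriction !pact_comp.
Qed.

Lemma restriction_inj (h h' : hom (prod_obj P) (pt_obj B)) :
  product_hom h -> product_hom h' -> restriction h = restriction h' -> h = h'.
Proof.
move=> ph ph' e; apply: pact_faithful => z.
by rewrite !product_hom_extension // e.
Qed.

Lemma restriction_central (h : hom (prod_obj P) (pt_obj B)) :
  product_hom h -> central_hom p U (restriction h).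
Proof.
move=> ph; split=> [a|o a x ax].
  by rewrite -pact_comp compA (proj1 ph) prod_pair2 pact_zero.
pose z i := projT1 (cid (proj2 product_pullback_elements _ _ (ax i))).
have z1 i : pact U (prod1 P) (z i) = a i by rewrite /z; case: cid => ? [].
have z2 i : pact U (prod2 P) (z i) = x i by rewrite /z; case: cid => ? [].
have := product_hom_extension (alg_op z) ph; rewrite !alg_funP.
under [X in _ = ext _ (alg_op X) _]funext do rewrite z1.
under [X in _ = ext _ _ (alg_op X)]funext do rewrite z2.
move=> e; apply: etrans (esym e) _; congr (alg_op _); apply: funext => i.
by rewrite product_hom_extension // z1 z2.
Qed.

(** The extension of a central k is a homomorphism by definition and lifts to
    the category because it is p applied to three morphisms.  Its compatibility
    with the structure maps over Y and over X follows from the Mal'cev laws. *)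
Lemma central_restriction (k : hom W (pt_obj B)) :
  central_hom p U k -> exists h, product_hom h /\ restriction h = k.
Proof.
move=> [kz kop].
have gP : is_hom (@alg_op _ _) (@alg_op _ _)
    (fun z => ext k (pact U (prod1 P) z) (pact U (prod2 P) z)).
  by move=> o z; rewrite !alg_funP; apply: kop => i; rewrite !pact_over.
pose u := k \o prod1 P; pose v := pt_sec B \o (zero_hom X X \o prod2 P).
pose w := pt_sec B \o prod2 P.
have [|h hE] := mc_lift mc (u := pt_fun u) (v := pt_fun v) (w := pt_fun w)
    (h := AlgHom gP).
  move=> z; rewrite -/(pact U u z) -/(pact U v z) -/(pact U w z).
  by rewrite !pact_comp pact_zero.
have h_over : pt_map (pt_obj B) \o h = pt_map (prod_obj P).
  apply: (mc_faithful mc) => z; rewrite act_comp hE.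
  change (pact_base U (pt_obj B) (ext k (pact U (prod1 P) z)
    (pact U (prod2 P) z)) = pact_base U (prod_obj P) z).
  rewrite /ext /malcev_extension (hom_malcev _ _ _ _ (@alg_funP _ _ _ _)).
  by rewrite !pact_over pact_split malcev_opr.
have h_under : h \o pt_sec (prod_obj P) = pt_sec (pt_obj B).
  apply: (mc_faithful mc) => y; rewrite act_comp hE.
  change (ext k (pact U (prod1 P) (pact_sec U (prod_obj P) y))
    (pact U (prod2 P) (pact_sec U (prod_obj P) y)) = pact_sec U (pt_obj B) y).
  rewrite /ext /malcev_extension !pact_under !pact_split.
  by rewrite malcev_opr.
pose H : hom (prod_obj P) (pt_obj B) := PointHom h_over h_under.
have HE z : pact U H z = ext k (pact U (prod1 P) z) (pact U (prod2 P) z).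
  exact: hE.
exists H; split; first split; apply: pact_faithful => z; rewrite !pact_comp HE.
- rewrite /ext /malcev_extension (hom_malcev _ _ _ _ (@alg_funP _ _ _ _)) kz.
  have sB x : pact U (pt_map B) (pact U (pt_sec B) x) = x.
    by rewrite -pact_comp pt_split pact_id.
  by rewrite !sB !pact_over malcev_opl.
- rewrite pact_pair1 pact_pair2 pact_id /ext /malcev_extension.
  by rewrite !pact_zero !pact_under malcev_opl.
- rewrite pact_pair1 pact_pair2 pact_id /ext /malcev_extension.
  by rewrite pact_zero pact_split malcev_opr.
Qed.

End Product.

Section Adjoint.
Variables (L : finite_products (Pt Y)) (X : Pt Y).
Let one_ := one (fp_one L).
Let F := terminal_change_of_base L X.

(** Since points over Y have a zero object, each of them is in a unique way a
    point over the terminal object, and likewise for morphisms. *)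
Definition point_of_object (W : Pt Y) : Pt one_ :=
  @Point (Pt Y) one_ W (bang (fp_one L) W) (zero_hom one_ W) (bang_unique _ _).

Definition point_of_hom (A G : Pt one_) (u : hom (pt_obj A) (pt_obj G)) :
    hom A G :=
  @PointHom (Pt Y) one_ A G u (bang_unique _ _)
    (etrans (terminal_zero _) (esym (terminal_zero _))).

Lemma cob_product_hom (A : Pt one_) (B : Pt X) (h : hom (F A) B) :
  product_hom (pt_fun h).
Proof.
split; first exact: pt_over h.
rewrite -(pt_under h); congr (_ \o prod_pair _ _ _).
by rewrite (terminal_zero (pt_sec A)) zero_compr.
Qed.

Lemma product_hom_cob (A : Pt one_) (B : Pt X) h :
  @product_hom (pt_obj A) X (fp_prod L (pt_obj A) X) B h ->
  exists h' : hom (F A) B, pt_fun h' = h.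
Proof.
move=> [h2 hs]; suff hu : h \o pt_sec (F A) = pt_sec B 
  by exists (@PointHom (Pt Y) X (F A) B h h2 hu).
rewrite -hs; congr (_ \o prod_pair _ _ _).
by rewrite (terminal_zero (pt_sec A)) zero_compr.
Qed.

Lemma restriction_fmap (A G : Pt one_) (B : Pt X) (h : hom (F G) B)
    (u : hom A G) :
  restriction (pt_fun (h \o fmap F u)) = restriction (pt_fun h) \o pt_fun u.
Proof.
pose PA := fp_prod L (pt_obj A) X; pose PG := fp_prod L (pt_obj G) X.
change ((pt_fun h \o prod_pair PG (pt_fun u \o prod1 PA) (prod2 PA)) \o
  prod_pair PA (idm _) (zero_hom _ _) =
  (pt_fun h \o prod_pair PG (idm _) (zero_hom _ _)) \o pt_fun u).
rewrite -[LHS]compA -[RHS]compA; congr (_ \o _).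
apply: prod_unique; rewrite [LHS]compA [RHS]compA !(prod_pair1, prod_pair2).
  by rewrite -compA prod_pair1 compm1 comp1m.
by rewrite zero_compr.
Qed.

(** Restriction is a bijection, natural in A, from the morphisms F A -> B onto
    the central morphisms A -> B; so it preserves and reflects universality. *)
Lemma universal_arrow_central (G : Pt one_) (B : Pt X) (e : hom (F G) B) :
  universal_arrow e <-> universal_central p U (restriction (pt_fun e)).
Proof.
have eP := cob_product_hom e; split=> [eU|[_ eU] A h].
  split; first exact: restriction_central.
  move=> W k /(central_restriction (fp_prod L W X))[h [hP hk]].
  have [h' h'E] := @product_hom_cob (point_of_object W) B h hP.
  have [u [ue uU]] := eU _ h'; exists (pt_fun u); split.
    by apply: etrans (esym (restriction_fmap e u)) _; rewrite ue h'E.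
  move=> v ve; rewrite (uU (point_of_hom (A := point_of_object W) v)) //.
  apply: point_hom_inj; apply: restriction_inj; try exact: cob_product_hom.
  by rewrite restriction_fmap h'E hk.
have hP := cob_product_hom h.
have [u [ue uU]] := eU _ _ (restriction_central hP).
exists (point_of_hom u); split.
  apply: point_hom_inj; apply: restriction_inj; try exact: cob_product_hom.
  by rewrite restriction_fmap.
by move=> v ve; apply: point_hom_inj; apply: uU;
  rewrite -ve restriction_fmap.
Qed.

Lemma adjoint_universal_central :
  has_right_adjoint F <->
  forall B : point X, exists G (k0 : hom G (pt_obj B)),
    universal_central p U k0.
Proof.
split=> [/right_adjoint_universal univ B|univ].
  have [G [e /universal_arrow_central eU]] := univ B.
  by exists (pt_obj G), (restriction (pt_fun e)).
apply: universal_right_adjoint => B; have [G [k0 k0U]] := univ B.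
have [h [hP hk]] := central_restriction (fp_prod L G X) (proj1 k0U).
have [e eE] := @product_hom_cob (point_of_object G) B h hP.
exists (point_of_object G), e; apply/universal_arrow_central.
by rewrite eE hk.
Qed.

End Adjoint.

Lemma algebraically_cartesian_closed_central :
  algebraically_cartesian_closed (Pt Y) <->
  forall (X : Pt Y) (B : point X), exists G (k0 : hom G (pt_obj B)),
    universal_central p U k0.
Proof.
split=> [[L LP] X|univ]; first by apply/(adjoint_universal_central L).
pose pb X Z W (f : hom X W) (g : hom Z W) := projT1 (cid (mc_pullback mc f g)).
exists (point_finite_products Y pb) => X.
by apply/adjoint_universal_central.
Qed.

End Classification.

(** The form of the hypothesis and of the conclusion in which they can be
    compared, since it mentions no choice of products or of adjoints. *)
Lemma fiberwise_central (T : theory) (p : term T 'I_3) (C : category)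
    (U : functor C (variety T)) :
  malcev_term p -> malcev_concrete p U ->
  fiberwise_algebraically_cartesian_closed C <->
  forall (Y : C) (X : Pt Y) (B : point X), exists G (k0 : hom G (pt_obj B)),
    universal_central p U k0.
Proof.
move=> mp mc; split=> [[_ acc] Y|univ].
  by apply/(algebraically_cartesian_closed_central mp mc).
split=> [|Y]; last by apply/(algebraically_cartesian_closed_central mp mc).
have [t] := mc_one mc; constructor; apply: (@FiniteLimits C t) => X Z W f g.
exact: projT1 (cid (mc_pullback mc f g)).
Qed.

(** * Topologizing a universal central homomorphism *)

Section Transfer.
Variables (T : theory) (p : term T 'I_3).
Let U := top_forget T.
Variables (Y : topological_algebras T) (X : Pt Y) (B : point X).
Let X' : Pt (U Y) := point_functor U Y X.
Let B' : point X' := fpoint (point_functor U Y) B.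
Variables (G : Pt (U Y)) (k0 : hom G (pt_obj B')).
Let Z : top_algebra T := pt_obj (pt_obj B).

Definition central_lift_incl (_ : unit) :
  alg_hom (pt_obj G) (top_forget_obj Z) := pt_fun k0.

Definition central_lift_obj : top_algebra T := initial_lift central_lift_incl.

(** The algebra G maps to Y through k0 and the topological algebra Z, where the
    map to Y is continuous. *)
Lemma central_lift_map_continuous :
  continuous (alg_fun (pt_map G) : central_lift_obj -> top_carrier Y).
Proof.
rewrite (_ : alg_fun (pt_map G) =
  top_fun (top_comp (pt_map (pt_obj B))
             (initial_lift_proj central_lift_incl tt))).
  exact: top_fun_continuous.
exact: (congr1 (fun h : alg_hom _ _ => alg_fun h) (esym (pt_over k0))).
Qed.

Definition central_lift_map : top_hom central_lift_obj Y :=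
  @TopHom T central_lift_obj Y (pt_map G) (alg_funP (pt_map G))
    central_lift_map_continuous.

Lemma central_lift_sec_continuous (i : unit) :
  continuous (fun y : top_carrier Y =>
    central_lift_incl i (alg_fun (pt_sec G) y) : Z).
Proof.
rewrite (_ : (fun y => _) = top_fun (pt_sec (pt_obj B))).
  exact: top_fun_continuous.
exact: (congr1 (fun h : alg_hom _ _ => alg_fun h) (pt_under k0)).
Qed.

Definition central_lift_sec : top_hom Y central_lift_obj :=
  initial_lift_hom central_lift_sec_continuous.

Lemma central_lift_split :
  top_comp central_lift_map central_lift_sec = top_id Y.
Proof.
apply: top_hom_inj.
exact: (congr1 (fun h : alg_hom _ _ => alg_fun h) (pt_split G)).
Qed.

Definition central_lift : Pt Y :=
  @Point (topological_algebras T) Y central_lift_obj central_lift_map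
    central_lift_sec central_lift_split.


Lemma central_lift_counit_over :
  top_comp (pt_map (pt_obj B)) (initial_lift_proj central_lift_incl tt) =
  central_lift_map.
Proof.
apply: top_hom_inj.
exact: (congr1 (fun h : alg_hom _ _ => alg_fun h) (pt_over k0)).
Qed.

Lemma central_lift_counit_under :
  top_comp (initial_lift_proj central_lift_incl tt) central_lift_sec =
  pt_sec (pt_obj B).
Proof.
apply: top_hom_inj.
exact: (congr1 (fun h : alg_hom _ _ => alg_fun h) (pt_under k0)).
Qed.

Definition central_lift_counit : hom central_lift (pt_obj B) :=
  @PointHom (topological_algebras T) Y central_lift (pt_obj B)
    (initial_lift_proj central_lift_incl tt)
    central_lift_counit_over central_lift_counit_under.

Section Factor.
Variables (W : Pt Y) (k : hom W (pt_obj B)).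
Variable u : hom (point_functor U Y W) G.
Hypothesis uk : k0 \o u = fmap (point_functor U Y) k.

Let pt_fun_eq (A D : Pt (U Y)) (v w : hom A D) (e : v = w) :
  alg_fun (pt_fun v) = alg_fun (pt_fun w) :=
  congr1 (fun h : point_hom A D => alg_fun (pt_fun h)) e.

Lemma central_lift_factor_continuous (i : unit) :
  continuous (fun x : top_carrier (pt_obj W) =>
    central_lift_incl i (alg_fun (pt_fun u) x) : Z).
Proof.
rewrite (_ : (fun x => _) = top_fun (pt_fun k)); last exact: pt_fun_eq uk.
exact: top_fun_continuous.
Qed.

Definition central_lift_factor_fun : top_hom (pt_obj W) central_lift_obj :=
  initial_lift_hom central_lift_factor_continuous.

Lemma central_lift_factor_over :
  top_comp central_lift_map central_lift_factor_fun = pt_map W.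
Proof.
apply: top_hom_inj.
exact: (congr1 (fun h : alg_hom _ _ => alg_fun h) (pt_over u)).
Qed.

Lemma central_lift_factor_under :
  top_comp central_lift_factor_fun (pt_sec W) = central_lift_sec.
Proof.
apply: top_hom_inj.
exact: (congr1 (fun h : alg_hom _ _ => alg_fun h) (pt_under u)).
Qed.

Definition central_lift_factor : hom W central_lift :=
  @PointHom (topological_algebras T) Y W central_lift central_lift_factor_fun
    central_lift_factor_over central_lift_factor_under.

End Factor.

Lemma central_lift_universal :
  universal_central p (identity_functor (variety T)) k0 ->
  universal_central p U central_lift_counit.
Proof.
move=> [k0c k0U]; split=> [|W k kc]; first exact: k0c.
have [u [uk uU]] := k0U (point_functor U Y W) (fmap (point_functor U Y) k) kc.
exists (central_lift_factor uk); split.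
  apply: point_hom_inj; apply: top_hom_inj.
  exact: (congr1 (fun h : point_hom (point_functor U Y W) (pt_obj B') =>
    alg_fun (pt_fun h)) uk).
move=> v vk; apply: point_hom_inj; apply: top_hom_inj.
pose v' : alg_hom (top_forget_obj (pt_obj W)) (pt_obj G) :=
  @AlgHom T (top_forget_obj (pt_obj W)) (pt_obj G) (top_fun (pt_fun v))
    (top_funP (pt_fun v)).
have v'o : alg_comp (pt_map G) v' = fmap U (pt_map W).
  apply: alg_hom_inj.
  exact: (congr1 (fun h : top_hom _ _ => top_fun h) (pt_over v)).
have v'u : alg_comp v' (fmap U (pt_sec W)) = pt_sec G.
  apply: alg_hom_inj.
  exact: (congr1 (fun h : top_hom _ _ => top_fun h) (pt_under v)).
pose V : hom (point_functor U Y W) G :=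
  @PointHom (variety T) (U Y) (point_functor U Y W) G v' v'o v'u.
have Vk : k0 \o V = fmap (point_functor U Y) k.
  apply: point_hom_inj; apply: alg_hom_inj.
  exact: (congr1 (fun h : point_hom W (pt_obj B) => top_fun (pt_fun h)) vk).
exact: (congr1 (fun h : point_hom (point_functor U Y W) G =>
  alg_fun (pt_fun h)) (uU V Vk)).
Qed.

End Transfer.

Theorem proposition2p7 (T : theory) :
  malcev T ->
  fiberwise_algebraically_cartesian_closed (variety T) ->
  fiberwise_algebraically_cartesian_closed (topological_algebras T).
Proof.
move=> [p mp] /(fiberwise_central mp (variety_malcev_concrete p)) univ.
apply/(fiberwise_central mp (topological_malcev_concrete p)) => Y X B.
have [G [k0 k0U]] := univ _ (point_functor (top_forget T) Y X)
  (fpoint (point_functor (top_forget T) Y) B).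
exists (central_lift k0), (central_lift_counit k0).
exact: central_lift_universal.
Qed.
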